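(* Consider the interconnected system, the local optimal control problems $\mathrm{OCP}_i(t)$ and the closed loop described in the context, with the packet exchange and the availability of the scalars $W_j(x_j(t))$ described there. Suppose that at time $t$ the problems $\mathrm{OCP}_i(t)$, $i=1,\dots,\ell$, are feasible, and that for the transition from $t$ to $t+1$, for every $i\in\{1,\dots,\ell\}$: (A) (shift margin) $x_i^{\mathrm{nom},\star}(l+1|t)\in\mathcal X_i\ominus\mathbb B_{\delta_i(l|t+1)}$ for all $l=1,\dots,M-1$; (B) (one-step terminal feasibility) there exists $v_i\in\mathcal U_i$ with $$W_i\bigl(g_i(\tilde x_i^{\mathrm{nom}}(M-1|t+1),\bar x_{\mathcal N_i}(M-1|t+1),v_i)\bigr)\le\max_{j\in\mathcal G_i^\gamma}\gamma_{ij}\bigl(W_j(x_j(t+1))\bigr).$$ Then the problems $\mathrm{OCP}_i(t+1)$, $i=1,\dots,\ell$, are feasible. Consequently, if (A) and (B) hold at every transition $t\to t+1$, $t\in\mathbb Z_{\ge0}$, and the problems $\mathrm{OCP}_i(0)$ are feasible, then the problems $\mathrm{OCP}_i(t)$ are feasible for all $t\in\mathbb Z_{\ge0}$ and all $i$ (recursive feasibility).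
   Context: Notation. $\|\cdot\|$ is the Euclidean norm, $\mathbb B_\Delta=\{e:\|e\|\le\Delta\}$, $\mathcal S\ominus\mathcal E=\{z: z+e\in\mathcal S\ \forall e\in\mathcal E\}$. For $v_{\mathcal N_i}=(v_j)_{j\in\mathcal N_i}$, $\|v_{\mathcal N_i}\|_{\mathcal N_i,\infty}=\max_{j\in\mathcal N_i}\|v_j\|$. Maxima over empty index sets are $0$. $\mathcal K$: continuous strictly increasing $\alpha:\mathbb R_{\ge0}\to\mathbb R_{\ge0}$ with $\alpha(0)=0$; $\mathcal K_\infty$: unbounded functions in $\mathcal K$; $\alpha<\mathrm{id}$ means $\alpha(s)<s$ for all $s>0$. System. $x_i(t+1)=g_i(x_i(t),x_{\mathcal N_i}(t),u_i(t))$, $i=1,\dots,\ell$, with constraint sets $\mathcal X_i\subseteq\mathbb R^{n_i}$, $\mathcal U_i\subseteq\mathbb R^{m_i}$, neighbor sets $\mathcal N_i\subset\{1,\dots,\ell\}\setminus\{i\}$, $x_{\mathcal N_i}=(x_j)_{j\in\mathcal N_i}$, $\mathcal X_{\mathcal N_i}=\prod_{j\in\mathcal N_i}\mathcal X_j$, $\mathcal X=\prod_i\mathcal X_i$, $\mathcal U=\prod_i\mathcal U_i$, $n=\sum_i n_i$, $g=(g_1,\dots,g_\ell)$, regarded as a map $g:\mathcal X\times\mathcal U\to\mathbb R^n$, $g(0,0)=0$; $g$ is $\mathcal K$-bounded: there are $\kappa_1,\kappa_2\in\mathcal K$ with $\|g(\xi,\mu)\|\le\kappa_1(\|\xi\|)+\kappa_2(\|\mu\|)$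 on $\mathcal X\times\mathcal U$ (and likewise each $g_i$ on $\mathcal X_i\times\mathcal X_{\mathcal N_i}\times\mathcal U_i$). There are constants $L_{i,1},L_{i,2}>0$, $L_{i,3}\ge0$ with $$\|g_i(\xi_i,\xi_{\mathcal N_i},\mu_i)-g_i(\xi_i',\xi_{\mathcal N_i}',\mu_i')\|\le L_{i,1}\|\xi_i-\xi_i'\|+L_{i,2}\|\xi_{\mathcal N_i}-\xi'_{\mathcal N_i}\|_{\mathcal N_i,\infty}+L_{i,3}\|\mu_i-\mu_i'\|$$ on the constraint domain $\mathcal X_i\times\mathcal X_{\mathcal N_i}\times\mathcal U_i$. Design data. $M\ge2$ integer, $\lambda>0$, functions $W_i:\mathbb R^{n_i}\to\mathbb R_{\ge0}$ with $\underline\alpha_i(\|\xi_i\|)\le W_i(\xi_i)\le\overline\alpha_i(\|\xi_i\|)$ for some $\underline\alpha_i,\overline\alpha_i\in\mathcal K_\infty$, and gains $\gamma_{ij}\in\mathcal K_\infty\cup\{0\}$ with $\gamma_{i_1i_2}\circ\gamma_{i_2i_3}\circ\cdots\circ\gamma_{i_ri_1}<\mathrm{id}$ for every cycle of distinct indices, $r=1,\dots,\ell$. $\mathcal G_i^\gamma=\{j:\gamma_{ij}\not\equiv0\}$. Packets. At time $t$ subsystem $i$ sends $(\bar x_i(l|t),\bar r_i(l|t))_{l=0}^{M-1}$ to the controllers of which it is a neighbor, where $\bar x_i(0|t)=x_i(t)$, $\bar r_i(0|t)=0$, and for $t\ge1$, $l=1,\dots,M-1$: $\bar x_i(l|t)=x_i^{\mathrm{nom},\star}(l+1|t-1)$,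 $\bar r_i(l|t)=r_i^\star(l+1|t-1)$. At $t=0$ packets (with nonnegative radii) are supplied by a feasible initialization procedure. At time $t$ controller $i$ knows the packets of all $j\in\mathcal N_i$ and the scalars $W_j(x_j(t))$, $j\in\mathcal G_i^\gamma$. Budget. $\mathcal B_i(l|t)=L_{i,2}\max_{j\in\mathcal N_i}\bar r_j(l|t)+d_i(l|t)$, $l=0,\dots,M-1$, where $d_i(l|t)=L_{i,2}\max_{j\in\mathcal N_i}\|\bar x_j(l|t)-\bar x_j(l+1|t-1)\|$ for $l\le M-2$ (for $t=0$, given nonnegative initialization values) and $d_i(M-1|t)=d_i^{\mathrm{ter}}(t)\ge0$ is prescribed. $\mathrm{OCP}_i(t)$: minimize over $(u_i(0|t),\dots,u_i(M-1|t))$ and $(r_i(1|t),\dots,r_i(M-1|t))$ the cost $\sum_{l=0}^{M-1}W_i(x_i^{\mathrm{nom}}(l|t))+\lambda\sum_{l=1}^{M-1}r_i(l|t)$ subject to: $x_i^{\mathrm{nom}}(0|t)=x_i(t)$; $x_i^{\mathrm{nom}}(l+1|t)=g_i(x_i^{\mathrm{nom}}(l|t),\bar x_{\mathcal N_i}(l|t),u_i(l|t))$ and $u_i(l|t)\in\mathcal U_i$ for $l=0,\dots,M-1$; $r_i(l|t)\ge0$ and $x_i^{\mathrm{nom}}(l|t)\in\mathcal X_i\ominus\mathbb B_{r_i(l|t)}$ for $l=1,\dots,M-1$; $r_i(l+1|t)\ge L_{i,1}r_i(l|t)+\mathcal B_i(l|t)$ for $l=0,\dots,M-2$, with $r_i(0|t):=0$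 fixed; and $W_i(x_i^{\mathrm{nom}}(M|t))\le\max_{j\in\mathcal G_i^\gamma}\gamma_{ij}(W_j(x_j(t)))$. Optimizers carry a star; existence of a minimizer is understood whenever an optimizer is invoked. $r_i^\star(0|t)=0$ and $r_i^\star(M|t):=L_{i,1}r_i^\star(M-1|t)+\mathcal B_i(M-1|t)$. The closed loop applies $u_i(t)=u_i^\star(0|t)$ for every $i$. Shifted candidate at $t+1$. $\tilde u_i(l|t+1)=u_i^\star(l+1|t)$, $l=0,\dots,M-2$; $\tilde x_i^{\mathrm{nom}}(0|t+1)=x_i(t+1)$, $\tilde x_i^{\mathrm{nom}}(l+1|t+1)=g_i(\tilde x_i^{\mathrm{nom}}(l|t+1),\bar x_{\mathcal N_i}(l|t+1),\tilde u_i(l|t+1))$; $\tilde r_i(0|t+1)=0$, $\tilde r_i(l+1|t+1)=L_{i,1}\tilde r_i(l|t+1)+\mathcal B_i(l|t+1)$; $\chi_i(0|t+1)=0$, $\chi_i(l+1|t+1)=L_{i,1}\chi_i(l|t+1)+L_{i,2}\|\bar x_{\mathcal N_i}(l|t+1)-\bar x_{\mathcal N_i}(l+1|t)\|_{\mathcal N_i,\infty}$ (all for $l=0,\dots,M-2$); $\delta_i(l|t+1)=\chi_i(l|t+1)+\tilde r_i(l|t+1)$, $l=1,\dots,M-1$. *)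

(* Defs.v *)
From mathcomp Require Import all_boot all_order all_algebra.
From mathcomp Require Import mathcomp_extra boolp classical_sets set_interval.
From mathcomp Require Import reals topology normedtype.

Set Implicit Arguments.
Unset Strict Implicit.
Unset Printing Implicit Defensive.

Import Order.TTheory GRing.Theory Num.Theory numFieldNormedType.Exports.

Local Open Scope classical_set_scope.
Local Open Scope ring_scope.

Definition enorm (R : realType) (k : nat) (v : 'rV[R]_k) : R :=
  Num.sqrt (\sum_j v 0 j ^+ 2).

Definition eball (R : realType) (k : nat) (Delta : R) : set 'rV[R]_k :=
  [set e | enorm e <= Delta].

Definition pontryagin_diff (R : realType) (k : nat) (S E : set 'rV[R]_k) :
  set 'rV[R]_k := [set z | forall e, E e -> S (z + e)].

(* Comparison functions R_{>=0} -> R_{>=0} are functions R -> R of which only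
   the values on `[0, +oo[ matter. *)
Definition classK (R : realType) (alpha : R -> R) : Prop :=
  [/\ {within `[0, +oo[, continuous alpha},
      forall s r, 0 <= s -> s < r -> alpha s < alpha r
    & alpha 0 = 0].

Definition classKinf (R : realType) (alpha : R -> R) : Prop :=
  classK alpha /\ forall y, exists2 s, 0 <= s & y < alpha s.

(* The family indexed by the neighbors of i, (v_j)_{j in N_i}, has type
   [forall j : {j | j \in nbr i}, 'rV_(dim (val j))]. *)
Record system (R : realType) (ell : nat) := System {
  dim : 'I_ell -> nat;
  udim : 'I_ell -> nat;
  nbr : 'I_ell -> {set 'I_ell};
  cX : forall i, set 'rV[R]_(dim i);
  cU : forall i, set 'rV[R]_(udim i);
  (* values outside cX i * prod_(j in nbr i) cX j * cU i are meaningless *)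
  dyn : forall i, 'rV[R]_(dim i) ->
    (forall j : {j : 'I_ell | j \in nbr i}, 'rV[R]_(dim (val j))) ->
    'rV[R]_(udim i) -> 'rV[R]_(dim i);
  L1 : 'I_ell -> R;
  L2 : 'I_ell -> R;
  L3 : 'I_ell -> R }.

Arguments dim {R ell} _ _.
Arguments udim {R ell} _ _.
Arguments nbr {R ell} _ _.
Arguments cX {R ell} _ _ _.
Arguments cU {R ell} _ _ _.
Arguments dyn {R ell} _ _ _ _ _.
Arguments L1 {R ell} _ _.
Arguments L2 {R ell} _ _.
Arguments L3 {R ell} _ _.

Section System.
Variables (R : realType) (ell : nat) (S : system R ell).

Definition nfamily (i : 'I_ell) : Type :=
  forall j : {j : 'I_ell | j \in nbr S i}, 'rV[R]_(dim S (val j)).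

Definition restr (i : 'I_ell) (v : forall j, 'rV[R]_(dim S j)) : nfamily i :=
  fun j => v (val j).

(* All the quantities maximized below are nonnegative, so taking the maximum
   together with 0 only matters for empty index sets. *)
Definition nnorm (i : 'I_ell) (v : nfamily i) : R :=
  \big[Num.max/0]_(j : {j : 'I_ell | j \in nbr S i}) enorm (v j).

Definition in_domain (i : 'I_ell) (xi : 'rV[R]_(dim S i)) (xN : nfamily i)
    (mu : 'rV[R]_(udim S i)) : Prop :=
  [/\ cX S i xi, forall j, cX S (val j) (xN j) & cU S i mu].

Definition gdyn (xi : forall i, 'rV[R]_(dim S i))
    (mu : forall i, 'rV[R]_(udim S i)) : 'rV[R]_(\sum_i dim S i) :=
  \mxrow_i dyn S i (xi i) (restr xi) (mu i).

Record system_ok : Prop := SystemOk {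
  nbr_irrefl : forall i, i \notin nbr S i;
  gdyn0 : gdyn (fun=> 0) (fun=> 0) = 0;
  gdyn_Kbounded : exists kappa1 kappa2 : R -> R,
    [/\ classK kappa1, classK kappa2 &
    forall (xi : forall i, 'rV[R]_(dim S i)) (mu : forall i, 'rV[R]_(udim S i)),
      (forall i, cX S i (xi i)) -> (forall i, cU S i (mu i)) ->
      enorm (gdyn xi mu) <=
        kappa1 (enorm (\mxrow_i xi i)) + kappa2 (enorm (\mxrow_i mu i))];
  dyn_Kbounded : forall i, exists kappa1 kappa2 kappa3 : R -> R,
    [/\ classK kappa1, classK kappa2, classK kappa3 &
    forall xi xN mu, in_domain xi xN mu ->
      enorm (dyn S i xi xN mu) <=
        kappa1 (enorm xi) + kappa2 (nnorm xN) + kappa3 (enorm mu)];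
  L1_gt0 : forall i, 0 < L1 S i;
  L2_gt0 : forall i, 0 < L2 S i;
  L3_ge0 : forall i, 0 <= L3 S i;
  dyn_lipschitz : forall i xi xN mu xi' xN' mu',
    in_domain xi xN mu -> in_domain xi' xN' mu' ->
    enorm (dyn S i xi xN mu - dyn S i xi' xN' mu') <=
      L1 S i * enorm (xi - xi') +
      L2 S i * nnorm (fun j => xN j - xN' j) +
      L3 S i * enorm (mu - mu') }.

Record design := Design {
  horizon : nat;
  weight : R;
  W : forall i, 'rV[R]_(dim S i) -> R;
  gain : 'I_ell -> 'I_ell -> R -> R }.

Arguments W _ _ _ : clear implicits.

Record design_ok (D : design) : Prop := DesignOk {
  horizon_ge2 : (2 <= horizon D)%N;
  weight_gt0 : 0 < weight D;
  W_ge0 : forall i xi, 0 <= W D i xi;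
  W_bounds : forall i, exists alow aup : R -> R,
    [/\ classKinf alow, classKinf aup &
    forall xi, alow (enorm xi) <= W D i xi <= aup (enorm xi)];
  gain_class : forall i j,
    classKinf (gain D i j) \/ (forall s, 0 <= s -> gain D i j s = 0);
  (* for c = [:: i_1; ..; i_r] the zip lists (i_1,i_2), .., (i_r,i_1) *)
  small_gain : forall c : seq 'I_ell, c != [::] -> uniq c ->
    forall s, 0 < s ->
    foldr (fun p => gain D p.1 p.2) s (zip c (rot 1 c)) < s }.

Definition gain_graph (D : design) (i : 'I_ell) : {set 'I_ell} :=
  [set j | `[< exists2 s, 0 <= s & gain D i j s != 0 >]].

(* First argument of the signals: time t; last argument of the predicted ones:
   stage l.  [xstar], [ustar], [rstar] carry the optimizers of the local
   problems; they are tied to these problems by [closed_loop_at] below. *)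
Record run := Run {
  x : nat -> forall i, 'rV[R]_(dim S i);
  xstar : nat -> forall i, nat -> 'rV[R]_(dim S i);
  ustar : nat -> forall i, nat -> 'rV[R]_(udim S i);
  rstar : nat -> 'I_ell -> nat -> R;
  xbar0 : forall i, nat -> 'rV[R]_(dim S i);
  rbar0 : 'I_ell -> nat -> R;
  d0 : 'I_ell -> nat -> R;
  dter : nat -> 'I_ell -> R }.

Section Run.
Variables (D : design) (P : run).
Local Notation M := (horizon D).

Record run_ok : Prop := RunOk {
  rbar0_ge0 : forall i l, (0 < l < M)%N -> 0 <= rbar0 P i l;
  d0_ge0 : forall i l, (l.+1 < M)%N -> 0 <= d0 P i l;
  dter_ge0 : forall t i, 0 <= dter P t i }.

Definition xbar (t : nat) (i : 'I_ell) (l : nat) : 'rV[R]_(dim S i) :=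
  match l, t with
  | 0, _ => x P t i
  | _, 0 => xbar0 P i l
  | _, t'.+1 => xstar P t' i l.+1
  end.

Definition rbar (t : nat) (i : 'I_ell) (l : nat) : R :=
  match l, t with
  | 0, _ => 0
  | _, 0 => rbar0 P i l
  | _, t'.+1 => rstar P t' i l.+1
  end.

Definition xbarN (t : nat) (i : 'I_ell) (l : nat) : nfamily i :=
  restr (fun j => xbar t j l).

Arguments xbarN t i l _ : clear implicits.

Definition dev (t : nat) (i : 'I_ell) (l : nat) : R :=
  if l == M.-1 then dter P t i else
  match t with
  | 0 => d0 P i l
  | t'.+1 => L2 S i *
      \big[Num.max/0]_(j in nbr S i) enorm (xbar t j l - xbar t' j l.+1)
  end.

Definition budget (t : nat) (i : 'I_ell) (l : nat) : R :=
  L2 S i * \big[Num.max/0]_(j in nbr S i) rbar t j l + dev t i l.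

Definition terminal_level (t : nat) (i : 'I_ell) : R :=
  \big[Num.max/0]_(j in gain_graph D i) gain D i j (W D j (x P t j)).

(* [xn l.+1 = g_i(xn l, xbar_{N_i} l, u l)] for a map g_i defined on the
   constraint domain only, hence the [in_domain] clause.  Only u 0 .. u (M-1),
   r 0 .. r (M-1) and xn 0 .. xn M are relevant. *)
Record admissible (t : nat) (i : 'I_ell) (xn : nat -> 'rV[R]_(dim S i))
    (u : nat -> 'rV[R]_(udim S i)) (r : nat -> R) : Prop := Admissible {
  adm_init : xn 0 = x P t i;
  adm_dom : forall l, (l < M)%N -> in_domain (xn l) (xbarN t i l) (u l);
  adm_dyn : forall l, (l < M)%N ->
    xn l.+1 = dyn S i (xn l) (xbarN t i l) (u l);
  adm_r0 : r 0 = 0;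
  adm_r_ge0 : forall l, (0 < l < M)%N -> 0 <= r l;
  adm_tube : forall l, (0 < l < M)%N ->
    pontryagin_diff (cX S i) (@eball R (dim S i) (r l)) (xn l);
  adm_r_step : forall l, (l.+1 < M)%N ->
    L1 S i * r l + budget t i l <= r l.+1;
  adm_terminal : W D i (xn M) <= terminal_level t i }.

Arguments admissible t i _ _ _ : clear implicits.

Definition cost (i : 'I_ell) (xn : nat -> 'rV[R]_(dim S i)) (r : nat -> R) : R :=
  \sum_(0 <= l < M) W D i (xn l) + weight D * \sum_(1 <= l < M) r l.

Arguments cost i _ _ : clear implicits.

Definition feasible (t : nat) (i : 'I_ell) : Prop :=
  exists xn u r, admissible t i xn u r.

Definition optimizer (t : nat) (i : 'I_ell) (xn : nat -> 'rV[R]_(dim S i))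
    (u : nat -> 'rV[R]_(udim S i)) (r : nat -> R) : Prop :=
  admissible t i xn u r /\
  forall xn' u' r', admissible t i xn' u' r' -> cost i xn r <= cost i xn' r'.

Arguments optimizer t i _ _ _ : clear implicits.

(* [rstar P t i M] is not a decision variable but is sent as the last radius
   of the next packet. *)
Definition closed_loop_at (t : nat) : Prop :=
  forall i, [/\ optimizer t i (xstar P t i) (ustar P t i) (rstar P t i),
    rstar P t i M = L1 S i * rstar P t i M.-1 + budget t i M.-1 &
    x P t.+1 i = dyn S i (x P t i) (restr (x P t)) (ustar P t i 0)].

(* The candidates below belong to time t.+1. *)
Fixpoint xtilde (t : nat) (i : 'I_ell) (l : nat) : 'rV[R]_(dim S i) :=
  match l with
  | 0 => x P t.+1 i
  | l'.+1 => dyn S i (xtilde t i l') (xbarN t.+1 i l') (ustar P t i l'.+1)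
  end.

Fixpoint rtilde (t : nat) (i : 'I_ell) (l : nat) : R :=
  match l with
  | 0 => 0
  | l'.+1 => L1 S i * rtilde t i l' + budget t.+1 i l'
  end.

Fixpoint chi (t : nat) (i : 'I_ell) (l : nat) : R :=
  match l with
  | 0 => 0
  | l'.+1 => L1 S i * chi t i l' +
      L2 S i * nnorm (fun j => xbarN t.+1 i l' j - xbarN t i l'.+1 j)
  end.

Definition delta (t : nat) (i : 'I_ell) (l : nat) : R :=
  chi t i l + rtilde t i l.

Definition shift_margin (t : nat) : Prop :=
  forall i l, (0 < l < M)%N ->
    pontryagin_diff (cX S i) (@eball R (dim S i) (delta t i l))
      (xstar P t i l.+1).

Definition terminal_feasible (t : nat) : Prop :=
  forall i, exists2 v, cU S i v &
    W D i (dyn S i (xtilde t i M.-1) (xbarN t.+1 i M.-1) v) <=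
      terminal_level t.+1 i.

End Run.
End System.

(* Main.v *)
(* The optimal input at time t, shifted by one step and completed by the input
   v_i of the one-step terminal condition, is admissible at time t+1.  The
   nominal trajectory it generates stays within chi_i(l) of the shifted optimal
   one, by the Lipschitz bound on g_i; since the latter has margin
   chi_i(l) + rtilde_i(l), the former keeps the margin rtilde_i(l). *)
From mathcomp Require Import all_boot all_order all_algebra.
From mathcomp Require Import classical_sets reals.
From mathcomp Require Import ring lra.
Require Import Defs.

Set Implicit Arguments.
Unset Strict Implicit.
Unset Printing Implicit Defensive.

Import Order.TTheory GRing.Theory Num.Theory.

Local Open Scope ring_scope.

Section Enorm.
Variables (R : realType) (k : nat).
Implicit Types u v : 'rV[R]_k.

Lemma enorm_ge0 u : 0 <= enorm u.
Proof. exact: sqrtr_ge0. Qed.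

Lemma enorm0 : enorm (0 : 'rV[R]_k) = 0.
Proof. by rewrite /enorm big1 ?sqrtr0// => j _; rewrite mxE expr0n. Qed.

Lemma sqr_enorm u : enorm u ^+ 2 = \sum_j u 0 j ^+ 2.
Proof. by rewrite sqr_sqrtr// sumr_ge0// => j _; exact: sqr_ge0. Qed.

Lemma enorm_eq0 u : enorm u = 0 -> u = 0.
Proof.
move=> u0; have /eqP := sqr_enorm u; rewrite u0 expr0n eq_sym.
rewrite psumr_eq0 => [/allP h|j _]; last exact: sqr_ge0.
apply/rowP => j; rewrite mxE; apply/eqP; rewrite -sqrf_eq0.
by apply: h; rewrite mem_index_enum.
Qed.

(** For nonzero vectors, expanding the nonnegative sum of the squares
    [(enorm v * u 0 j - enorm u * v 0 j) ^+ 2] and cancelling the positive factor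
    [enorm u * enorm v] gives the bound. *)
Lemma enorm_cauchy_schwarz u v :
  \sum_j u 0 j * v 0 j <= enorm u * enorm v.
Proof.
have [/enorm_eq0 ->|u0] := eqVneq (enorm u) 0.
  by rewrite enorm0 mul0r big1// => j _; rewrite mxE mul0r.
have [/enorm_eq0 ->|v0] := eqVneq (enorm v) 0.
  by rewrite enorm0 mulr0 big1// => j _; rewrite mxE mulr0.
have uv0 : 0 < enorm u * enorm v by rewrite mulr_gt0// lt0r ?u0 ?v0 enorm_ge0.
have : 0 <= \sum_j (enorm v * u 0 j - enorm u * v 0 j) ^+ 2.
  by rewrite sumr_ge0// => j _; exact: sqr_ge0.
under eq_bigr => j _.
  rewrite (_ : _ ^+ 2 = enorm v ^+ 2 * u 0 j ^+ 2 + enorm u ^+ 2 * v 0 j ^+ 2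
    - (2 * (enorm u * enorm v)) * (u 0 j * v 0 j)); last by ring.
  over.
rewrite sumrB big_split /= -!mulr_sumr -!sqr_enorm => h.
rewrite -(ler_pM2l uv0); lra.
Qed.

Lemma enormD u v : enorm (u + v) <= enorm u + enorm v.
Proof.
rewrite -(ler_pXn2r (ltn0Sn 1)) ?nnegrE ?addr_ge0 ?enorm_ge0//.
rewrite sqr_enorm; under eq_bigr => j _ do rewrite mxE sqrrD -mulr_natr.
rewrite !big_split /= -mulr_suml -!sqr_enorm.
have := enorm_cauchy_schwarz u v; lra.
Qed.

End Enorm.

Lemma bigmaxr_ge0 (R : realDomainType) (I : Type) (s : seq I) (p : pred I)
    (F : I -> R) : 0 <= \big[Num.max/0]_(i <- s | p i) F i.
Proof.
by elim/big_rec : _ => // i y _ y0; rewrite le_max y0 orbT.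
Qed.

Section ErosionByBall.
Variables (R : realType) (k : nat) (A : set 'rV[R]_k).

Lemma pontryagin_diff_ball_sub r z : 0 <= r ->
  pontryagin_diff A (@eball R k r) z -> A z.
Proof. by move=> r0 /(_ 0); rewrite addr0; apply; rewrite /eball/= enorm0. Qed.

(** By the triangle inequality [w - z + e] lies in the ball of radius [c + r]. With [c] a value of
    [chi], this trades the margin [delta] for the margin [rtilde]. *)
Lemma pontryagin_diff_ball_shift c r z w : enorm (w - z) <= c ->
  pontryagin_diff A (@eball R k (c + r)) z ->
  pontryagin_diff A (@eball R k r) w.
Proof.
move=> wz zA e er; rewrite (_ : w + e = z + (w - z + e)).
  by apply: zA; apply: (le_trans (enormD _ _)); exact: lerD.
by rewrite addrA addrC [z + _]addrC subrK addrC.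
Qed.

End ErosionByBall.

Section Transition.
Variables (R : realType) (ell : nat) (S : system R ell).
Variables (D : design S) (P : run S).
Hypotheses (hS : system_ok S) (hD : design_ok D) (hP : run_ok D P).
Local Notation M := (horizon D).

(** At a successor time the sign is known for every [l], whereas at time 0 the values [d0] are
    controlled only at stages below [M.-1]. *)
Lemma budget_succ_ge0 t i l : 0 <= budget D P t.+1 i l.
Proof.
rewrite addr_ge0 ?mulr_ge0 ?bigmaxr_ge0 ?(ltW (L2_gt0 hS i))//.
rewrite /dev; case: ifP => _; first exact: dter_ge0 hP _ _.
by rewrite mulr_ge0 ?bigmaxr_ge0 ?(ltW (L2_gt0 hS i)).
Qed.

Lemma rtilde_ge0 t i l : 0 <= rtilde D P t i l.
Proof.
elim: l => [|l IH] //=.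
by rewrite addr_ge0 ?mulr_ge0 ?budget_succ_ge0 ?(ltW (L1_gt0 hS i)).
Qed.

Lemma chi_ge0 t i l : 0 <= chi P t i l.
Proof.
elim: l => [|l IH] //=.
by rewrite addr_ge0 ?mulr_ge0 ?bigmaxr_ge0 ?(ltW (L1_gt0 hS i))
  ?(ltW (L2_gt0 hS i)).
Qed.

Lemma delta_ge0 t i l : 0 <= delta D P t i l.
Proof. by rewrite addr_ge0 ?chi_ge0 ?rtilde_ge0. Qed.

Section OneStep.
Variable t : nat.
Hypotheses (hcl : closed_loop_at D P t) (hA : shift_margin D P t).

Let M_gt1 : (1 < M)%N := horizon_ge2 hD.

Let xstar_admissible i :
  admissible D P t (xstar P t i) (ustar P t i) (rstar P t i).
Proof. by have [[]] := hcl i. Qed.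

Lemma x_succ_eq i : x P t.+1 i = xstar P t i 1.
Proof.
have [_ _ ->] := hcl i.
rewrite (adm_dyn (xstar_admissible i) (ltnW M_gt1)).
by rewrite (adm_init (xstar_admissible i)).
Qed.

(** Stage 1 is a constrained stage of the old problem because [M] is at least 2. Later stages use
    the shift margin, which also covers the terminal state [xstar P t i M]. *)
Lemma xstar_succ_cX i l : (l < M)%N -> cX S i (xstar P t i l.+1).
Proof.
case: l => [|l] lM; first by have [] := adm_dom (xstar_admissible i) M_gt1.
by apply: (pontryagin_diff_ball_sub (delta_ge0 t i l.+1)); exact: hA.
Qed.

Lemma xbar_succ_cX i l : (l < M)%N -> cX S i (xbar P t.+1 i l).
Proof.
case: l => [|l] lM /=; first by rewrite x_succ_eq; exact: xstar_succ_cX.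
exact: xstar_succ_cX.
Qed.

(** Closeness is a premise here so that the induction proving it in [xtilde_close] can call on
    membership in [cX] at the current stage. *)
Lemma xtilde_margin i l : (0 < l < M)%N ->
  enorm (xtilde P t i l - xstar P t i l.+1) <= chi P t i l ->
  pontryagin_diff (cX S i) (@eball R (dim S i) (rtilde D P t i l))
    (xtilde P t i l).
Proof. by move=> lM h; apply: (pontryagin_diff_ball_shift h); exact: hA. Qed.

Lemma xtilde_cX_of_close i l : (l < M)%N ->
  enorm (xtilde P t i l - xstar P t i l.+1) <= chi P t i l ->
  cX S i (xtilde P t i l).
Proof.
case: l => [|l] lM h; first by rewrite /= x_succ_eq; exact: xstar_succ_cX.
by apply: (pontryagin_diff_ball_sub (rtilde_ge0 t i l.+1)); exact: xtilde_margin.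
Qed.

(** The Lipschitz bound holds only on the constraint domain, so closeness at stage [l] is first
    turned into membership of [xtilde P t i l]; the bound then reproduces the recursion of [chi]. *)
Lemma xtilde_close i l : (l < M)%N ->
  enorm (xtilde P t i l - xstar P t i l.+1) <= chi P t i l.
Proof.
elim: l => [|l IH] lM; first by rewrite /= x_succ_eq subrr enorm0.
have lM' := ltnW lM; have close := IH lM'.
have dom := adm_dom (xstar_admissible i) lM.
have domt : in_domain (xtilde P t i l) (xbarN P t.+1 l) (ustar P t i l.+1).
  split; first exact: xtilde_cX_of_close.
  - by move=> j; exact: xbar_succ_cX.
  - by case: dom.
rewrite (adm_dyn (xstar_admissible i) lM) /=.
apply: (le_trans (dyn_lipschitz hS domt dom)).
(* Both trajectories use the same input, so the [L3] term vanishes; the neighbor term is exactly the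
   one in [chi]. *)
rewrite subrr enorm0 mulr0 addr0 lerD2r ler_wpM2l//.
exact: ltW (L1_gt0 hS i).
Qed.

Lemma shifted_feasible i : terminal_feasible D P t -> feasible D P t.+1 i.
Proof.
move=> /(_ i)[v vU vW]; have M_gt0 := ltnW M_gt1.
pose u l := if l == M.-1 then v else ustar P t i l.+1.
(* At stage [M], [xtilde] would apply [ustar P t i M], which lies beyond the optimal input sequence;
   [v] takes its place. *)
pose xn l := if l == M then
  dyn S i (xtilde P t i M.-1) (xbarN P t.+1 M.-1) v else xtilde P t i l.
have xnE l : (l < M)%N -> xn l = xtilde P t i l.
  by move=> lM; rewrite /xn ltn_eqF.
(* The radius inequality holds with equality for [rtilde], by its definition. *)
exists xn, u, (rtilde D P t i); split=> //.
- by rewrite xnE.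
- move=> l lM; split.
  + by rewrite xnE//; apply: xtilde_cX_of_close => //; exact: xtilde_close.
  + by move=> j; exact: xbar_succ_cX.
  + rewrite /u; case: eqP => // /eqP lM1.
    (* Away from the last stage, the shifted index is still a stage of the problem at time [t]. *)
    have lM2 : (l.+1 < M)%N by rewrite ltn_neqAle lM andbT -(prednK M_gt0) eqSS.
    by have [] := adm_dom (xstar_admissible i) lM2.
- move=> l lM; rewrite (xnE l)// /xn /u.
  rewrite (_ : (l.+1 == M) = (l == M.-1)); last by rewrite -[RHS]eqSS prednK.
  by case: eqP => [->|].
- by move=> l _; exact: rtilde_ge0.
- move=> l /[dup] lM /andP[_ lltM]; rewrite xnE//.
  by apply: xtilde_margin => //; exact: xtilde_close.
- by rewrite /xn eqxx.
Qed.

End OneStep.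
End Transition.

Theorem theorem1 (R : realType) (ell : nat) (S : system R ell)
    (D : design S) (P : run S)
    (hS : system_ok S) (hD : design_ok D) (hP : run_ok D P) :
  (forall t : nat,
     (forall i, feasible D P t i) -> closed_loop_at D P t ->
     shift_margin D P t -> terminal_feasible D P t ->
     forall i, feasible D P t.+1 i)
  /\
  ((forall t : nat, (forall i, feasible D P t i) ->
      [/\ closed_loop_at D P t, shift_margin D P t & terminal_feasible D P t]) ->
   (forall i, feasible D P 0 i) ->
   forall (t : nat) i, feasible D P t i).
Proof.
split=> [t _ hcl hA hB i|hAB h0]; first exact: shifted_feasible.
(* Feasibility at time [t] gives access to the closed-loop relations and both conditions for the
   next transition. *)
elim=> // t IH i; have [hcl hA hB] := hAB t IH.
exact: shifted_feasible.
Qed.
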